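(* For every real $d>0$ and every integer $n\ge 1$, $$R_{n+1}(d)=\prod_{k=1}^{n}\left(d+1+2\sqrt{d}\,\cos\left(\frac{k\pi}{n+1}\right)\right).$$
   Context: For $d>0$ and $m\ge 1$, the repunit of length $m$ in base $d$ is $R_m(d)=\sum_{j=0}^{m-1}d^{j}$ (so $R_m(1)=m$). *)

(* Defs.v *)
From mathcomp Require Import all_boot all_order all_algebra.
From mathcomp Require Import reals.

Set Implicit Arguments.
Unset Strict Implicit.
Unset Printing Implicit Defensive.

Import GRing.Theory Num.Theory.

Local Open Scope ring_scope.

Definition repunit (R : realType) (m : nat) (d : R) : R :=
  \sum_(0 <= j < m) d ^+ j.

(* Main.v *)
Require Import Defs.
From mathcomp Require Import all_boot all_order all_algebra.
From mathcomp Require Import reals trigo.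
From mathcomp Require Import ring.

Set Implicit Arguments.
Unset Strict Implicit.
Unset Printing Implicit Defensive.

Import Order.TTheory GRing.Theory Num.Theory.

Local Open Scope ring_scope.

(** With [s = sqrt d], the identity is the factorization over its roots of a
    Chebyshev polynomial of the second kind, evaluated at [s + s^-1].

    Rescaled to be monic, these polynomials satisfy [S_0 = 1], [S_1 = 'X] and
    [S_(n+2) = 'X S_(n+1) - S_n].  This one recurrence does two jobs.  Read at
    [2 cos t] it is the addition formula
    [sin ((n+3) t) + sin ((n+1) t) = 2 cos t sin ((n+2) t)], so that
    [sin t * S_n (2 cos t) = sin ((n+1) t)] ([chebS_cos]); hence [S_n] vanishes
    at the [n] distinct points [2 cos (k pi / (n+1))] and is the product of the
    corresponding linear factors ([chebS_factor]).  Read at [s + s^-1] and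
    rescaled by powers of [s], it becomes the recurrence
    [R_(n+3) = (d + 1) R_(n+2) - d R_(n+1)] of the repunits, so that
    [s ^ n * S_n (s + s^-1) = R_(n+1) (d)] ([chebS_repunit]).

    Distributing [s ^ n] over the [n] factors turns each of them into
    [d + 1 - 2 s cos (k pi / (n+1))], and the symmetry [k -> n + 1 - k] changes
    the sign of the cosines. *)

(** Carrying two consecutive terms makes the order-two recurrence structural. *)
Fixpoint chebS_pair (R : nzRingType) (n : nat) : {poly R} * {poly R} :=
  if n is m.+1 then
    let: (p, q) := chebS_pair R m in (q, 'X * q - p)
  else (1, 'X).

(** The Chebyshev polynomial of the second kind [U_n] in the variable [x / 2],
    which makes it monic. *)
Definition chebS (R : nzRingType) (n : nat) : {poly R} := (chebS_pair R n).1.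

Lemma chebS0 (R : nzRingType) : chebS R 0 = 1.
Proof. by []. Qed.

Lemma chebS1 (R : nzRingType) : chebS R 1 = 'X.
Proof. by []. Qed.

Lemma chebSSS (R : nzRingType) n :
  chebS R n.+2 = 'X * chebS R n.+1 - chebS R n.
Proof. by rewrite /chebS /=; case: (chebS_pair R n). Qed.

Lemma nat_ind2 (P : nat -> Prop) :
  P 0%N -> P 1%N -> (forall n, P n -> P n.+1 -> P n.+2) -> forall n, P n.
Proof.
move=> P0 P1 PSS n; suff: P n /\ P n.+1 by case.
by elim: n => [|n [IH1 IH2]]; split => //; apply: PSS.
Qed.

Lemma chebS_size_monic (R : nzRingType) n :
  size (chebS R n) = n.+1 /\ chebS R n \is monic.
Proof.
elim/nat_ind2: n => [|| n [szn _] [szn1 mon1]].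
- by rewrite chebS0 size_poly1 monic1.
- by rewrite chebS1 size_polyX monicX.
have nz1 : chebS R n.+1 != 0 by rewrite -size_poly_eq0 szn1.
have szX : size ('X * chebS R n.+1) = n.+3.
  by rewrite -commr_polyX size_mulX // szn1.
have lt : (size (- chebS R n) < size ('X * chebS R n.+1)%R)%N.
  by rewrite size_polyN szn szX ltnW.
rewrite chebSSS size_polyDl // szX; split => //.
by rewrite monicE lead_coefDl // -monicE monicMl ?monicX.
Qed.

Section RealChebyshev.
Variable R : realType.
Implicit Types (s t d : R) (n k : nat).

(** Multiplying by [sin t] makes the formula hold for every [t], including
    the zeros of [sin]. *)
Lemma chebS_cos n t : sin t * (chebS R n).[2 * cos t] = sin (n.+1%:R * t).
Proof.
elim/nat_ind2: n => [||n IH0 IH1].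
- by rewrite chebS0 hornerC mulr1 mul1r.
- by rewrite chebS1 hornerX [in RHS]mulr_natl sin_mulr2n; ring.
rewrite chebSSS !hornerE mulrBr mulrCA IH0 IH1.
have -> : n.+3%:R * t = n.+2%:R * t + t by rewrite -(natr1 n.+2); ring.
have -> : n.+1%:R * t = n.+2%:R * t - t by rewrite -(natr1 n.+1); ring.
by rewrite sinB sinD; ring.
Qed.

Lemma sin_natpi k : sin (k%:R * pi) = 0 :> R.
Proof.
elim: k => [|k IH]; first by rewrite mul0r sin0.
by rewrite -natr1 mulrDl mul1r sinDpi IH oppr0.
Qed.

Lemma chebS_angle_itv n k : (1 <= k < n.+1)%N ->
  0 < k%:R * (pi : R) / n.+1%:R < pi.
Proof.
move=> /andP[k0 kn]; have pi0 := pi_gt0 R.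
rewrite divr_gt0 ?mulr_gt0 ?ltr0n //= ltr_pdivrMr ?ltr0n //.
by rewrite mulrC ltr_pM2l // ltr_nat.
Qed.

Lemma chebS_root n k : (1 <= k < n.+1)%N ->
  root (chebS R n) (2 * cos (k%:R * pi / n.+1%:R)).
Proof.
move=> kn; set t := _ / _.
have sint : sin t != 0 by rewrite gt_eqF // sin_gt0_pi // chebS_angle_itv.
apply/eqP/(mulfI sint); rewrite mulr0 chebS_cos /t mulrC divfK ?pnatr_eq0 //.
exact: sin_natpi.
Qed.

(** The roots are distinct because [cos] is injective on [[0, pi]]; being as
    many as the degree of a monic polynomial, they account for all of it. *)
Lemma chebS_factor n :
  chebS R n =
    \prod_(1 <= k < n.+1) ('X - (2 * cos (k%:R * pi / n.+1%:R))%:P).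
Proof.
have [sz mon] := chebS_size_monic R n.
pose rs : seq R :=
  [seq 2 * cos (k%:R * pi / n.+1%:R) | k <- index_iota 1 n.+1].
have -> : chebS R n = \prod_(z <- rs) ('X - z%:P); last by rewrite big_map.
rewrite -[RHS]scale1r -(monicP mon); apply: all_roots_prod_XsubC.
- by rewrite sz size_map size_iota subn1.
- by apply/allP => _ /mapP[k + ->]; rewrite mem_index_iota; apply: chebS_root.
rewrite uniq_rootsE map_inj_in_uniq ?iota_uniq // => j k.
rewrite !mem_index_iota => /chebS_angle_itv /andP[j0 jpi].
move=> /chebS_angle_itv /andP[k0 kpi] /mulfI.
rewrite pnatr_eq0 => /(_ isT) /cos_inj.
rewrite !in_itv /= !ltW // => /(_ isT isT).
have n0 : n.+1%:R != 0 :> R by rewrite pnatr_eq0.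
have pi0 : (pi : R) != 0 by rewrite gt_eqF ?pi_gt0.
by move=> /(divIf n0) /(mulIf pi0) /eqP; rewrite eqr_nat => /eqP.
Qed.

Lemma repunitS n d : repunit n.+1 d = repunit n d + d ^+ n.
Proof. by rewrite /repunit big_nat_recr. Qed.

(** Comparing recurrences avoids the quotient
    [(s ^ (n+1) - s ^ -(n+1)) / (s - s^-1)], undefined at [s = 1]. *)
Lemma chebS_repunit n s : s != 0 ->
  s ^+ n * (chebS R n).[s + s^-1] = repunit n.+1 (s ^+ 2).
Proof.
move=> s0; elim/nat_ind2: n => [||n IH0 IH1].
- by rewrite chebS0 hornerC /repunit big_nat1 !expr0 mulr1.
- rewrite chebS1 hornerX 2!repunitS /repunit big_nil expr0 !expr1; field.
  exact: s0.
have -> : s ^+ n.+2 * (chebS R n.+2).[s + s^-1] =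
    (s ^+ 2 + 1) * (s ^+ n.+1 * (chebS R n.+1).[s + s^-1])
    - s ^+ 2 * (s ^+ n * (chebS R n).[s + s^-1]).
  by rewrite chebSSS hornerD hornerN hornerM hornerX !exprS; field.
by rewrite IH0 IH1 (repunitS n.+2) (repunitS n.+1) !exprS; ring.
Qed.

Lemma cos_pi_rev n k : (k <= n.+1)%N ->
  cos ((n.+1 - k)%:R * pi / n.+1%:R) = - cos (k%:R * pi / n.+1%:R) :> R.
Proof.
move=> kn; rewrite natrB // mulrBl mulrBl mulrAC divff ?pnatr_eq0 // mul1r.
by rewrite addrC cosDpi cosN.
Qed.

End RealChebyshev.

Theorem theorem6p4 (R : realType) (d : R) (n : nat) (hd : 0 < d)
    (hn : (1 <= n)%N) :
  repunit n.+1 d =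
  \prod_(1 <= k < n.+1)
    (d + 1 + 2 * Num.sqrt d * cos (k%:R * pi / n.+1%:R)).
Proof.
set s := Num.sqrt d.
have s0 : s != 0 by rewrite gt_eqF // sqrtr_gt0.
have sd : s ^+ 2 = d by rewrite sqr_sqrtr // ltW.
rewrite -{1}sd -chebS_repunit // chebS_factor horner_prod.
have -> : s ^+ n = \prod_(1 <= k < n.+1) s by rewrite prodr_const_nat subn1.
rewrite -big_split /= big_nat_rev /=; apply: eq_big_nat => k /andP[_ kn].
rewrite add1n subSS !hornerE cos_pi_rev ?(ltnW kn) // -sd.
by field.
Qed.
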